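(* Let $n\ge2$ and $1\le p<n$. Let $\varphi$ satisfy conditions (1)–(5) and assume $\lim_{t\to0^+}t/\varphi(t)=m<\infty$. Let $G\subset\mathbb R^n$ be the mushroom domain described below. Assume that there exist $q\in[1,\infty)$ and $C\in\mathbb R$ such that $$\inf_{b\in\mathbb R}\|u-b\|_{L^q(G)}\le C\|\nabla u\|_{L^p(G)}$$ holds for all $u\in L^1_p(G)$. Then $q=\frac{np}{n-p}$, and there exists $t_0>0$ such that $\varphi(t)\approx t$ for all $t\in(0,t_0]$.
   Context: Conditions on $\varphi:[0,\infty)\to[0,\infty)$: (1) continuous; (2) strictly increasing; (3) $\varphi(0)=\lim_{t\to0^+}\varphi(t)=0$; (4) there is $C_\varphi\ge1$ with $\varphi(t_1)/t_1\le C_\varphi\varphi(t_2)/t_2$ whenever $0<t_1\le t_2$; (5) there is $C^{\Delta_2}_\varphi\ge1$ with $\varphi(2t)\le C^{\Delta_2}_\varphi\varphi(t)$ for all $t>0$. $\varphi(t)\approx t$ on $(0,t_0]$ means there are constants $0<c_1\le c_2$ with $c_1t\le\varphi(t)\le c_2t$ there. Mushroom domain: Let $(r_m)_{m\ge1}$ be a decreasing sequence of positive numbers converging to $0$ with $\varphi(r_m)\le r_m$ for all $m$. Let $Q=\{x\in\mathbb R^n: x_i>0\text{ for all }i\}$. For each $m$, let $Q_m$ be a closed cube of side length $2r_m$ and $P_m$ a closed rectangular box with one side of length $r_m$ and the remaining $n-1$ sides of length $2\varphi(r_m)$. Each $P_m$ is placed outside $Q$ with one of its faces of size $(2\varphi(r_m))^{n-1}$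 lying in the face $\{x_1=0,\ x_2,\dots,x_n>0\}$ of $Q$ (its side of length $r_m$ perpendicular to that face), and the cube $Q_m$ is attached to the opposite face of $P_m$, forming a ''mushroom'' $Q_m\cup P_m$; the mushrooms are pairwise disjoint and each has distance at least $1$ and at most $4$ from the origin. Let $Q_m^*,P_m^*$ be images of $Q_m,P_m$ under an isometry moving them onto the face $\{x_2=0,\ x_1,x_3,\dots,x_n>0\}$ of $Q$ in the same way (pairwise disjoint, at distance between $1$ and $4$ from the origin). Set $G=\operatorname{int}\big(Q\cup\bigcup_{m=1}^\infty(Q_m\cup P_m\cup Q_m^*\cup P_m^* )\big)$. $L^1_p(G)=\{u\in L^1_{loc}(G):|\nabla u|\in L^p(G)\}$. *)

(* Defs.v *)
From HB Require Import structures.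
From mathcomp Require Import all_boot all_order all_algebra.
From mathcomp Require Import all_classical all_reals all_analysis.
Set Implicit Arguments. Unset Strict Implicit. Unset Printing Implicit Defensive.
Import Order.TTheory GRing.Theory Num.Theory.
Import numFieldNormedType.Exports.
Local Open Scope classical_set_scope.
Local Open Scope ring_scope.

Section Defs.
Variable R : realType.

Definition enorm (n : nat) (x : 'rV[R]_n) : R := Num.sqrt (\sum_(i < n) x 0 i ^+ 2).

Definition dist0 (n : nat) (A : set 'rV[R]_n) : R := inf [set enorm x | x in A].

Definition isometry (n : nat) (T : 'rV[R]_n -> 'rV[R]_n) :=
  forall x y, enorm (T x - T y) = enorm (x - y).

Definition box (n : nat) (lo hi : 'I_n -> R) : set 'rV[R]_n :=
  [set x | forall i, lo i <= x 0 i <= hi i].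

Definition borelRn (n : nat) : set (set 'rV[R]_n) := <<s [set U | open U] >>.
Definition borel_fun (n : nat) (f : 'rV[R]_n -> R) :=
  forall B : set R, open B -> borelRn (f @^-1` B).

(* n-dimensional Lebesgue integral of a nonnegative function, computed as the
   iterated one-dimensional Lebesgue integral (Tonelli); it is only used on
   nonnegative Borel functions, for which it coincides with the integral
   against n-dimensional Lebesgue measure. *)
Fixpoint iint (n : nat) : ('rV[R]_n -> \bar R) -> \bar R :=
  match n return ('rV[R]_n -> \bar R) -> \bar R with
  | 0 => fun f => f 0
  | n'.+1 => fun f =>
      (\int[lebesgue_measure]_(t in [set: R])
          iint (fun y : 'rV[R]_n' => f (row_mx (const_mx t : 'rV[R]_1) y)))%E
  end.

Definition Lnorm_on (n : nat) (G : set 'rV[R]_n) (s : R) (f : 'rV[R]_n -> R) : \bar R :=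
  ((iint (fun x => (\1_G x * `|f x| `^ s)%:E)) `^ s^-1)%E.

Definition loc_int (n : nat) (G : set 'rV[R]_n) (f : 'rV[R]_n -> R) :=
  borel_fun f /\
  forall K : set 'rV[R]_n, compact K -> K `<=` G ->
    (iint (fun x => (\1_K x * `|f x|)%:E) < +oo)%E.

Definition ebasis (n : nat) (i : 'I_n) : 'rV[R]_n := delta_mx 0 i.
Definition partial (n : nat) (i : 'I_n) (f : 'rV[R]_n -> R) : 'rV[R]_n -> R :=
  fun x => 'D_(ebasis i) f x.
Definition iter_partial (n : nat) (s : seq 'I_n) (f : 'rV[R]_n -> R) :=
  foldr (@partial n) f s.
Definition smooth (n : nat) (f : 'rV[R]_n -> R) :=
  forall s : seq 'I_n, continuous (iter_partial s f) /\
    forall (i : 'I_n) (x : 'rV[R]_n), derivable (iter_partial s f) x (ebasis i).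
Definition supp (n : nat) (f : 'rV[R]_n -> R) := closure [set x | f x != 0].
Definition test_fun (n : nat) (G : set 'rV[R]_n) (psi : 'rV[R]_n -> R) :=
  smooth psi /\ compact (supp psi) /\ supp psi `<=` G.

(* g is the weak i-th partial derivative of u on G:
   int_G (u d_i psi + g psi) = 0 for all test functions psi (the integrand is
   integrable, and its integral vanishes iff the integrals of its positive
   and negative parts agree) *)
Definition weak_partial (n : nat) (G : set 'rV[R]_n) (u : 'rV[R]_n -> R)
    (i : 'I_n) (g : 'rV[R]_n -> R) :=
  forall psi, test_fun G psi ->
    let h := fun x => \1_G x * (u x * partial i psi x + g x * psi x) in
    (iint (fun x => (`|h x|)%:E) < +oo)%E /\
    iint (fun x => (Num.max (h x) 0)%:E) = iint (fun x => (Num.max (- h x) 0)%:E).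

Definition grad_norm (n : nat) (g : 'I_n -> 'rV[R]_n -> R) : 'rV[R]_n -> R :=
  fun x => enorm (\row_(i < n) g i x).

Definition L1p_with (n : nat) (G : set 'rV[R]_n) (p : R)
    (u : 'rV[R]_n -> R) (g : 'I_n -> 'rV[R]_n -> R) :=
  loc_int G u /\
  (forall i, loc_int G (g i) /\ weak_partial G u i (g i)) /\
  (Lnorm_on G p (grad_norm g) < +oo)%E.

Definition admissible_phi (phi : R -> R) :=
  (forall t, 0 <= t -> 0 <= phi t) /\
  {within [set t | 0 <= t], continuous phi} /\
  (forall s t, 0 <= s -> s < t -> phi s < phi t) /\
  (phi 0 = 0 /\ phi x @[x --> 0^'+] --> 0) /\
  (exists Cphi, 1 <= Cphi /\
     forall t1 t2, 0 < t1 -> t1 <= t2 -> phi t1 / t1 <= Cphi * (phi t2 / t2)) /\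
  (exists Cd, 1 <= Cd /\ forall t, 0 < t -> phi (2 * t) <= Cd * phi t).

(* Coordinates are indexed from 0: coordinate k (val k = 0 or 1) is x_{k+1}. *)
Definition orthant (n : nat) : set 'rV[R]_n := [set x | forall i, 0 < x 0 i].

Definition stem (n : nat) (k : nat) (phi : R -> R) (r : R) (a : 'I_n -> R) :=
  box (fun i : 'I_n => if val i == k then - r else a i)
      (fun i : 'I_n => if val i == k then 0 else a i + 2 * phi r).
Definition cap (n : nat) (k : nat) (r : R) (c : 'I_n -> R) :=
  box (fun i : 'I_n => if val i == k then - (3 * r) else c i)
      (fun i : 'I_n => if val i == k then - r else c i + 2 * r).

Definition mushroom_family (n : nat) (k : nat) (phi : R -> R) (r : nat -> R)
    (a c : nat -> 'I_n -> R) :=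
  (* the face of the stem lies in the open face of Q *)
  (forall m (i : 'I_n), val i != k -> 0 < a m i) /\
  (* the opposite face of the stem lies in a face of the cap (cap attached) *)
  (forall m (i : 'I_n), val i != k -> c m i <= a m i /\ a m i + 2 * phi (r m) <= c m i + 2 * r m) /\
  (forall m m', m <> m' ->
     (cap k (r m) (c m) `|` stem k phi (r m) (a m)) `&`
     (cap k (r m') (c m') `|` stem k phi (r m') (a m')) = set0) /\
  (forall m, 1 <= dist0 (cap k (r m) (c m) `|` stem k phi (r m) (a m)) <= 4).

Definition mushroom_domain (n : nat) (phi : R -> R) (r : nat -> R)
    (a c aS cS : nat -> 'I_n -> R) : set 'rV[R]_n :=
  interior (@orthant n `|` \bigcup_m (cap 0 (r m) (c m) `|` stem 0 phi (r m) (a m)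
                                     `|` cap 1 (r m) (cS m) `|` stem 1 phi (r m) (aS m))).

Definition mushroom_data (n : nat) (phi : R -> R) (r : nat -> R)
    (a c aS cS : nat -> 'I_n -> R) :=
  (forall m, 0 < r m) /\ (forall m, r m.+1 <= r m) /\ r @ \oo --> 0 /\
  (forall m, phi (r m) <= r m) /\
  mushroom_family 0 phi r a c /\
  mushroom_family 1 phi r aS cS /\
  (exists T : 'rV[R]_n -> 'rV[R]_n, isometry T /\
     forall m, T @` stem 0 phi (r m) (a m) = stem 1 phi (r m) (aS m) /\
               T @` cap 0 (r m) (c m) = cap 1 (r m) (cS m)).

End Defs.

(* Main.v *)
(* The exponent comes from scaling inside the orthant alone.  With
   u_L(x) = (1 - |x / L - (2, ..., 2)|^2)_+^2, supported in the cube [L, 3L]^n,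
   the gradient has L^p norm at most const * L^(n/p - 1), while for every b one
   of two fixed cubes of side L/n (one where u_L >= 1/4, one where u_L = 0)
   forces |u_L - b| >= 1/8 there, so that the left-hand side is at least
   const * L^(n/q).  Letting L tend to 0 and to infinity gives
   n/q = n/p - 1.  The comparison phi(t) ~ t follows from the finiteness of
   lim t / phi(t) and from phi(r_k) <= r_k, which makes this limit at least 1. *)
Require Import Defs.
From HB Require Import structures.
From mathcomp Require Import all_boot all_order all_algebra.
From mathcomp Require Import all_classical all_reals all_analysis.
From mathcomp Require Import measurable_realfun ring lra.
Import Order.TTheory GRing.Theory Num.Theory.
Import numFieldNormedType.Exports.
Local Open Scope classical_set_scope.
Local Open Scope ring_scope.

(** * Iterated integrals *)

Section IteratedIntegral.
Set Implicit Arguments. Unset Strict Implicit.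
Context {R : realType}.
Implicit Types (n : nat).

Local Notation cons t y := (row_mx (const_mx t : 'rV[R]_1) y).
Local Notation mu := (@lebesgue_measure R).

(** The integral of a nonnegative function is the supremum over the simple functions below it, and a
    larger function has more of them. The argument is free of measurability, so [le_iint] applies to
    arbitrary nonnegative integrands. *)
Lemma ge0_le_integralT (f g : R -> \bar R) : (forall t, 0 <= f t)%E ->
  (forall t, f t <= g t)%E -> (\int[mu]_t f t <= \int[mu]_t g t)%E.
Proof.
move=> f0 fg; have g0 t : (0 <= g t)%E by exact: le_trans (fg t).
rewrite !ge0_integralTE//; apply: le_ereal_sup => _ [h hf <-]; exists h => //.
by move=> t; exact: le_trans (fg t).
Qed.

Lemma consE0 n (t : R) (y : 'rV[R]_n) : cons t y 0 (ord0 : 'I_n.+1) = t.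
Proof.
transitivity (cons t y 0 (lshift n (ord0 : 'I_1))); last by rewrite row_mxEl mxE.
congr (row_mx _ _ _ _); exact: val_inj.
Qed.

Lemma consES n (t : R) (y : 'rV[R]_n) j : cons t y 0 (lift ord0 j : 'I_n.+1) = y 0 j.
Proof.
rewrite -[RHS](row_mxEr (const_mx t : 'rV_1) y); congr (row_mx _ _ _ _); exact: val_inj.
Qed.

Lemma forall_consP n (t : R) (y : 'rV[R]_n) (P : 'I_n.+1 -> R -> Prop) :
  (forall i, P i (cons t y 0 i)) <-> P ord0 t /\ forall j, P (lift ord0 j) (y 0 j).
Proof.
split=> [H|[H0 HS] i]; last first.
  by case: (unliftP ord0 i) => [j|] ->; rewrite ?consES ?consE0.
by split=> [|j]; [have := H ord0; rewrite consE0|have := H (lift ord0 j); rewrite consES].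
Qed.

Lemma iint_ge0 n (f : 'rV[R]_n -> \bar R) : (forall x, 0 <= f x)%E -> (0 <= iint f)%E.
Proof.
elim: n f => [|n IH] f f0 //=; apply: integral_ge0 => t _.
exact: IH.
Qed.

Lemma iint_EFin_ge0 n (f : 'rV[R]_n -> R) : (forall x, 0 <= f x) ->
  (0 <= iint (fun x => (f x)%:E))%E.
Proof. by move=> f0; apply: iint_ge0 => x; rewrite lee_fin. Qed.

Lemma le_iint n (f g : 'rV[R]_n -> \bar R) : (forall x, 0 <= f x)%E ->
  (forall x, f x <= g x)%E -> (iint f <= iint g)%E.
Proof.
elim: n f g => [|n IH] f g f0 fg //=; apply: ge0_le_integralT => t.
  exact: iint_ge0.
exact: IH.
Qed.

(** * Cubes and their volume *)

Definition cube n (lo hi : R) : set 'rV[R]_n := box (fun=> lo) (fun=> hi).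

Lemma cube_cons n (a b t : R) (y : 'rV[R]_n) :
  \1_(@cube n.+1 a b) (cons t y) = \1_(`[a, b]%classic) t * \1_(@cube n a b) y :> R.
Proof.
rewrite !indicE -natrM mulnb; congr ((nat_of_bool _)%:R).
apply/idP/andP => [|[]]; rewrite !inE /cube /box /= ?in_itv/=.
  by move=> /(@forall_consP _ _ _ (fun _ z => a <= z <= b)).
move=> abt H; apply/(@forall_consP _ _ _ (fun _ z => a <= z <= b)) => //.
Qed.

(** The factor [A] is arbitrary so that the induction hypothesis can absorb the indicator of the
    first coordinate. *)
Lemma iint_cube n (A a b : R) : 0 <= A -> a <= b ->
  iint (fun x : 'rV[R]_n => (A * \1_(cube a b) x)%:E) = (A * (b - a) ^+ n)%:E.
Proof.
move=> A0 ab; elim: n A A0 => [|n IH] A A0 /=.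
  rewrite indicE mem_set ?mulr1 ?expr0//.
  by move=> [].
rewrite -/addn; under eq_integral => t _.
  rewrite (_ : (fun y => _) = (fun y : 'rV[R]_n =>
    ((A * \1_(`[a, b]%classic) t) * \1_(cube a b) y)%:E)); last first.
    by apply/funext => y; rewrite cube_cons mulrA.
  rewrite IH ?mulr_ge0//.
  rewrite mulrAC EFinM.
  over.
rewrite ge0_integralZl//=; [|exact/measurable_EFinP|]; last first.
  by rewrite lee_fin mulr_ge0// exprn_ge0 ?subr_ge0.
rewrite integral_indic//= setIT lebesgue_measure_itv/= lte_fin.
rewrite lt_neqAle ab andbT.
(* The length of the interval comes with the test [a < b]; when [a = b] both sides are [0], because
   the exponent [n.+1] is positive. *)
case: eqVneq => [->|_] /=; first by rewrite subrr mule0 expr0n mulr0.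
by rewrite -EFinD -EFinM exprSr mulrA.
Qed.

(** * Additivity and homogeneity of the iterated integral *)

(** Measurability in the form suited to [iint]: at each level the inner integral is a measurable
    function of the outer variable, which is what additivity of the one-dimensional integral
    requires there. *)
Fixpoint iterable n : ('rV[R]_n -> R) -> Prop :=
  match n return ('rV[R]_n -> R) -> Prop with
  | 0 => fun=> True
  | n'.+1 => fun f => (forall t, iterable (fun y : 'rV[R]_n' => f (cons t y))) /\
      measurable_fun [set: R] (fun t => iint (fun y : 'rV[R]_n' => (f (cons t y))%:E))
  end.

Lemma iintD n (f g : 'rV[R]_n -> R) : iterable f -> iterable g ->
  (forall x, 0 <= f x) -> (forall x, 0 <= g x) ->
  iint (fun x => (f x + g x)%:E) = (iint (fun x => (f x)%:E) + iint (fun x => (g x)%:E))%E.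
Proof.
elim: n f g => [|n IH] f g //= [itf mf] [itg mg] f0 g0.
rewrite -ge0_integralD//; last 2 first.
- by move=> t _; exact: iint_EFin_ge0.
- by move=> t _; exact: iint_EFin_ge0.
by apply: eq_integral => t _; rewrite IH.
Qed.

Lemma iterableD n (f g : 'rV[R]_n -> R) : iterable f -> iterable g ->
  (forall x, 0 <= f x) -> (forall x, 0 <= g x) -> iterable (fun x => f x + g x).
Proof.
elim: n f g => [|n IH] f g //= [itf mf] [itg mg] f0 g0; split=> [t|]; first exact: IH.
under eq_fun do rewrite iintD//.
exact: emeasurable_funD.
Qed.

Lemma iintZl n (k : R) (f : 'rV[R]_n -> R) : iterable f -> 0 <= k ->
  (forall x, 0 <= f x) ->
  iint (fun x => (k * f x)%:E) = (k%:E * iint (fun x => (f x)%:E))%E.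
Proof.
elim: n f => [|n IH] f //= [itf mf] k0 f0.
rewrite -ge0_integralZl//; first by apply: eq_integral => t _; rewrite IH.
by move=> t _; exact: iint_EFin_ge0.
Qed.

Lemma iterableZl n (k : R) (f : 'rV[R]_n -> R) : iterable f -> 0 <= k ->
  (forall x, 0 <= f x) -> iterable (fun x => k * f x).
Proof.
elim: n f => [|n IH] f //= [itf mf] k0 f0; split=> [t|]; first exact: IH.
under eq_fun do rewrite iintZl//.
exact: emeasurable_funM.
Qed.

Lemma iterable_cube n (A a b : R) : 0 <= A -> a <= b ->
  iterable (fun x : 'rV[R]_n => A * \1_(cube a b) x).
Proof.
elim: n A => [|n IH] A A0 ab //=; rewrite -/addn.
have E t : (fun y => A * \1_(@cube n.+1 a b) (cons t y)) =
    (fun y : 'rV[R]_n => ((A * \1_(`[a, b]%classic) t) * \1_(cube a b) y)).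
  by apply/funext => y; rewrite cube_cons mulrA.
split=> [t|]; first by rewrite E; apply: IH; rewrite ?mulr_ge0.
rewrite (_ : (fun t => _) = fun t => (A * \1_(`[a, b]%classic) t * (b - a) ^+ n)%:E).
  apply/measurable_EFinP; apply: measurable_funM => //; exact: measurable_funM.
apply/funext => t.
rewrite -(@iint_cube n) ?mulr_ge0//; congr iint.
by apply/funext => y; rewrite cube_cons mulrA.
Qed.

(* The modulus of continuity is uniform so that slices stay in the class. *)
Definition bounded_uc n (M : R) (f : 'rV[R]_n -> R) :=
  [/\ forall x, 0 <= f x,
      exists2 A : R, 0 <= A & forall x, f x <= A * \1_(cube (- M) M) x &
      forall e : R, 0 < e -> exists2 d : R, 0 < d &
        forall x y : 'rV[R]_n, (forall i, `|x 0 i - y 0 i| < d) -> f x <= f y + e].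

(** * Continuity of slice integrals *)

Lemma bounded_uc_cons n (M t : R) (f : 'rV[R]_n.+1 -> R) :
  bounded_uc M f -> bounded_uc M (fun y : 'rV[R]_n => f (cons t y)).
Proof.
move=> [f0 [A A0 fA] fu]; split=> //.
  exists A => // y; apply: le_trans (fA _) _; rewrite cube_cons.
  rewrite ler_wpM2l// ler_piMl// indicE; case: (_ \in _) => //=.
move=> e /fu[d d0 fd]; exists d => // y z yz; apply: fd => i.
by case: (unliftP ord0 i) => [j|] ->; rewrite ?consES ?consE0 ?subrr ?normr0.
Qed.

Lemma bounded_uc_fin n (M : R) (f : 'rV[R]_n -> R) : 0 <= M -> bounded_uc M f ->
  iint (fun x => (f x)%:E) \is a fin_num.
Proof.
move=> M0 [f0 [A A0 fA] _]; rewrite ge0_fin_numE; last exact: iint_EFin_ge0.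
apply: (@le_lt_trans _ _ (iint (fun x => (A * \1_(cube (- M) M) x)%:E))).
  by apply: le_iint => // x; rewrite lee_fin.
by rewrite iint_cube ?ltry//; lra.
Qed.

(** For close [t] and [t'] the slice at [t] exceeds the slice at [t'] by at most [e] on the cube,
    and it vanishes off the cube. The excess is thus dominated by [e] times the indicator of a cube
    of side [M + M]. *)
Lemma bounded_uc_slice_close n (M : R) (f : 'rV[R]_n.+1 -> R) : 0 <= M -> bounded_uc M f ->
  (forall t, iterable (fun y : 'rV[R]_n => f (cons t y))) ->
  forall e : R, 0 < e -> exists2 d : R, 0 < d & forall t t' : R, `|t - t'| < d ->
   (iint (fun y : 'rV[R]_n => (f (cons t y))%:E) <=
    iint (fun y : 'rV[R]_n => (f (cons t' y))%:E) + (e * (M + M) ^+ n)%:E)%E.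
Proof.
move=> M0 [f0 [A A0 fA] fu] itf e e0; have [d d0 fd] := fu e e0.
have M2 : - M <= M by lra.
exists d => // t t' tt'.
have -> : (M + M) = M - - M by rewrite opprK.
rewrite -iint_cube//; last exact: ltW.
rewrite -iintD//; last 2 first.
  by apply: iterable_cube => //; exact: ltW.
  by move=> x; rewrite mulr_ge0// ltW.
apply: le_iint => y; rewrite lee_fin; first exact: f0.
have [yM|yM] := pselect (cube (- M) M y).
  have -> : \1_(cube (- M) M) y = 1 :> R by rewrite indicE mem_set.
  rewrite mulr1; apply: fd => i.
  by case: (unliftP ord0 i) => [j|] ->; rewrite ?consES ?consE0 ?subrr ?normr0.
apply: le_trans (fA _) _; rewrite cube_cons.
have -> : \1_(cube (- M) M) y = 0 :> R by rewrite indicE memNset.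
by rewrite !mulr0 addr0.
Qed.

Lemma bounded_uc_slice_continuous n (M : R) (f : 'rV[R]_n.+1 -> R) : 0 <= M -> bounded_uc M f ->
  (forall t, iterable (fun y : 'rV[R]_n => f (cons t y))) ->
  continuous (fun t : R => fine (iint (fun y : 'rV[R]_n => (f (cons t y))%:E))).
Proof.
move=> M0 fM itf t; apply/cvgrPdist_le => /= e e0.
(* The [+ 1] keeps the denominator positive when [M = 0]. *)
have VM : 0 < (M + M) ^+ n + 1 by rewrite ltr_wpDl// exprn_ge0// addr_ge0.
have e'0 : 0 < e / ((M + M) ^+ n + 1) by rewrite divr_gt0.
have [d d0 H] := bounded_uc_slice_close M0 fM itf e'0.
have K : e / ((M + M) ^+ n + 1) * (M + M) ^+ n <= e.
  by rewrite mulrAC ler_pdivrMr// ler_pM2l// lerDl.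
near=> s.
have ts : `|t - s| < d by near: s; exact: cvgr_dist_lt.
have st : `|s - t| < d by rewrite distrC.
have := H _ _ ts; have := H _ _ st.
have fint r := bounded_uc_fin M0 (bounded_uc_cons r fM).
rewrite -[X in (X <= _)%E]fineK// -[X in (_ <= X + _)%E]fineK// -EFinD lee_fin => h1.
rewrite -[X in (X <= _)%E]fineK// -[X in (_ <= X + _)%E]fineK// -EFinD lee_fin => h2.
rewrite ler_norml; apply/andP; split; lra.
Unshelve. all: by end_near. Qed.

(** Slices stay in the class, which feeds the induction on the dimension, and the slice integral is
    continuous in [t], hence measurable. *)
Lemma bounded_uc_iterable n (M : R) (f : 'rV[R]_n -> R) : 0 <= M -> bounded_uc M f ->
  iterable f.
Proof.
move=> M0; elim: n f => [|n IH] f fM //=.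
have itf t : iterable (fun y : 'rV[R]_n => f (cons t y)).
  exact/IH/bounded_uc_cons.
split=> //.
rewrite (_ : (fun t => _) =
    EFin \o (fun t : R => fine (iint (fun y : 'rV[R]_n => (f (cons t y))%:E)))).
  apply/measurable_EFinP; apply: continuous_measurable_fun.
  exact: bounded_uc_slice_continuous M0 fM itf.
by apply/funext => t /=; rewrite fineK//; exact: bounded_uc_fin M0 (bounded_uc_cons t fM).
Qed.

(** * Translation invariance *)

(** This is the substitution rule for [t + s], whose derivative is the constant [1]. *)
Lemma ge0_integral_shift (G : R -> R) (s : R) : continuous G -> (forall t, 0 <= G t) ->
  (\int[mu]_t (G (t + s))%:E = \int[mu]_t (G t)%:E)%E.
Proof.
move=> cG G0.
have dF (x : R) : is_derive x 1 (fun t : R => t + s) 1.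
  by apply: is_derive_eq; rewrite addr0.
have F1 : derive1 (fun t : R => t + s) = cst 1.
  by apply/funext => x; rewrite derive1E derive_val.
rewrite [RHS](increasing_ge0_integration_by_substitutionT (F := fun t => t + s)) ?F1//.
- by apply: eq_integral => t _ /=; rewrite mulr1.
- by move=> x y; rewrite ltrD2r.
- by move=> x; exact: cst_continuous.
- exact: is_cvg_cst.
- exact: is_cvg_cst.
- apply/cvgrNyPle => A; near=> x; rewrite -lerBrDr; near: x.
  by apply: nbhs_ninfty_le; exact: num_real.
- apply/cvgryPge => A; near=> x; rewrite -lerBlDr; near: x.
  by apply: nbhs_pinfty_ge; exact: num_real.
Unshelve. all: by end_near. Qed.

(** A shift of a later coordinate acts inside each slice and is handled by induction. A shift of the
    first coordinate translates the slice integral, a continuous function of one variable. *)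
Lemma iint_shift n (M s : R) (f : 'rV[R]_n -> R) (i : 'I_n) : 0 <= M -> bounded_uc M f ->
  iint (fun x => (f (s *: ebasis R i + x))%:E) = iint (fun x => (f x)%:E).
Proof.
move=> M0; elim: n f i => [|n IH] f i fM; first by case: i.
rewrite /=; case: (unliftP ord0 i) => [j|] ->.
  apply: eq_integral => t _.
  rewrite -(IH _ j (bounded_uc_cons t fM)); congr iint; apply/funext => y; congr (f _)%:E.
  apply/rowP => k; rewrite [LHS]mxE; case: (unliftP ord0 k) => [l|] ->.
    by rewrite !consES !mxE/= (inj_eq lift_inj).
  by rewrite !consE0 !mxE/= mulr0 add0r.
have itf t : iterable (fun y : 'rV[R]_n => f (cons t y)).
  exact: bounded_uc_iterable M0 (bounded_uc_cons t fM).
have fint t := bounded_uc_fin M0 (bounded_uc_cons t fM).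
have := @ge0_integral_shift (fun t => fine (iint (fun y : 'rV[R]_n => (f (cons t y))%:E))) s
  (bounded_uc_slice_continuous M0 fM itf).
under eq_integral do rewrite fineK//.
under [in RHS]eq_integral do rewrite fineK//.
move=> <-; last first.
  by move=> t; apply/fine_ge0/iint_EFin_ge0 => y; case: fM.
apply: eq_integral => t _; congr iint; apply/funext => y; congr (f _)%:E.
apply/rowP => k; rewrite [LHS]mxE; case: (unliftP ord0 k) => [l|] ->.
  by rewrite !consES !mxE/= mulr0 add0r.
by rewrite !consE0 !mxE eqxx mulr1 addrC.
Qed.

End IteratedIntegral.

(** * Weak derivatives of C^1 functions *)

Section WeakDerivative.
Set Implicit Arguments. Unset Strict Implicit.
Context {R : realType}.
Implicit Types (n : nat).

(** Both derivatives are limits of the same difference quotient. One-variable rules, such as the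
    mean value theorem and the chain rule, thereby reach partial derivatives. *)
Lemma is_derive_line n (f : 'rV[R]_n -> R) (x v : 'rV[R]_n) (t d : R) :
  is_derive (t *: v + x) v f d <-> is_derive t 1 (fun s : R => f (s *: v + x)) d.
Proof.
have E : (fun h : R => h^-1 *: ((f \o shift (t *: v + x)) (h *: v) - f (t *: v + x))) =
  (fun h : R => h^-1 *: (((fun s : R => f (s *: v + x)) \o shift t) (h *: (1 : R))
                         - f (t *: v + x))).
  apply/funext => h /=; congr (_ *: (f _ - _)).
  by rewrite addrA -scalerDl [_ *: 1]mulr1.
by split=> -[df fd]; apply: DeriveDef; move: df fd; rewrite /derivable /derive E.
Qed.

Lemma continuous_coordP n (f : 'rV[R]_n -> R) (x : 'rV[R]_n) :
  {for x, continuous f} -> forall e : R, 0 < e -> exists2 d : R, 0 < d &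
    forall y : 'rV[R]_n, (forall i, `|x 0 i - y 0 i| < d) -> `|f x - f y| < e.
Proof.
move=> fx e e0.
move/cvgrPdist_lt: fx => /(_ e e0) /nbhs_ballP[d /= d0 H].
exists d => // y xy; apply: H; split=> // i j; rewrite ord1; exact: xy.
Qed.

Lemma compact_cube n (a b : R) : compact (@cube R n a b).
Proof.
have := @rV_compact R n (fun=> `[a, b]%classic) (fun=> @segment_compact _ a b).
by congr compact; apply/seteqP; split=> x H i; have := H i; rewrite /= in_itv.
Qed.

Lemma cube_normP n (M : R) (x : 'rV[R]_n) : cube (- M) M x <-> forall i, `|x 0 i| <= M.
Proof. by split=> H i; have := H i; rewrite ler_norml. Qed.

(** * Uniform continuity and bounds for compactly supported functions *)

Definition vanishes_off_cube n (M : R) (w : 'rV[R]_n -> R) :=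
  forall x, ~ cube (- M) M x -> w x = 0.

(** Heine's theorem: local moduli around the points of the cube are made uniform by compactness. A
    pair with a point in the cube is covered, by symmetry if need be, and a pair outside gives
    [0 - 0]. *)
Lemma compact_support_uc n (M : R) (w : 'rV[R]_n -> R) : continuous w ->
  vanishes_off_cube M w ->
  forall e : R, 0 < e -> exists2 d : R, 0 < d &
    forall x y : 'rV[R]_n, (forall i, `|x 0 i - y 0 i| < d) -> `|w x - w y| < e.
Proof.
move=> cw w0 e e0.
pose P (d : R) (x : 'rV[R]_n) :=
  forall y : 'rV[R]_n, (forall i, `|x 0 i - y 0 i| < d) -> `|w x - w y| < e.
have H : \forall d \near (0 : R)^'+, cube (- M) M `<=` P d.
  apply: ((compact_near_coveringP _).1 (@compact_cube n (- M) M)) => x _.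
  have e2 : 0 < e / 2 by rewrite divr_gt0.
  have [d d0 Hd] := continuous_coordP (cw x) e2.
  have d2 : 0 < d / 2 by rewrite divr_gt0.
  (* Half of [d] is spent on going from [x] to [x'] and half on going from [x'] to [y], so both
     values are within [e / 2] of [w x]. *)
  exists (ball x (d / 2), [set r | r < d / 2]) => /=; first split.
  - exact: nbhsx_ballx.
  - exact: nbhs_right_lt.
  move=> [x' r] /= [[_ xx'] rd] y x'y.
  have h1 : `|w x - w x'| < e / 2.
    by apply: Hd => i; apply: lt_le_trans (xx' 0 i) _; lra.
  have h2 : `|w x - w y| < e / 2.
    apply: Hd => i; rewrite -(subrKA (x' 0 i)); apply: le_lt_trans (ler_normD _ _) _.
    have := x'y i; have := xx' 0 i; rewrite /ball /= => a b; lra.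
  rewrite -(subrKA (w x)); apply: le_lt_trans (ler_normD _ _) _; rewrite distrC; lra.
near ((0 : R)^'+) => d; exists d; first by near: d; exact: nbhs_right_gt.
have Hd : cube (- M) M `<=` P d by near: d.
move=> x y xy; have [xM|xM] := pselect (cube (- M) M x); first exact: Hd.
have [yM|yM] := pselect (cube (- M) M y); last by rewrite !w0// subrr normr0.
by rewrite distrC; apply: Hd => // i; rewrite distrC.
Unshelve. all: by end_near. Qed.

Lemma continuous_bounded_on_compact n (w : 'rV[R]_n -> R) (K : set 'rV[R]_n) :
  continuous w -> compact K -> exists2 A : R, 0 <= A & forall x, K x -> `|w x| <= A.
Proof.
move=> cw cK.
have /compact_bounded[A [_ HA]] : compact (w @` K).
  by apply: continuous_compact => //; exact: continuous_subspaceT.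
exists (`|A| + 1) => [|x Kx]; first by rewrite addr_ge0.
by apply: (HA (`|A| + 1)); [rewrite (le_lt_trans (ler_norm _))// ltrDl|exists x].
Qed.

Lemma compact_sub_cube n (K : set 'rV[R]_n) : compact K ->
  exists2 M : R, 0 <= M & K `<=` cube (- M) M.
Proof.
move=> /compact_bounded[A [_ HA]]; exists (`|A| + 1) => [|x Kx]; first by rewrite addr_ge0.
apply/cube_normP => i; apply: (@le_trans _ _ `|x|); last first.
  by apply: HA => //; rewrite (le_lt_trans (ler_norm _))// ltrDl.
rewrite [leRHS]/Num.norm /= mx_normrE; apply/bigmax_geP; right => /=.
by exists (0, i).
Qed.

(** Taking the positive part does not increase differences, so it keeps the modulus of continuity.
    Applied to [w] and [- w], this puts both parts of [w] where [iint] is additive and shift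
    invariant. *)
Lemma bounded_uc_pos n (M : R) (w : 'rV[R]_n -> R) : continuous w ->
  vanishes_off_cube M w ->
  bounded_uc M (fun x => Num.max (w x) 0).
Proof.
move=> cw w0; split=> [x|| e e0]; first by rewrite le_max lexx orbT.
  have [A A0 wA] := continuous_bounded_on_compact cw (@compact_cube n (- M) M).
  exists A => // x; rewrite indicE; case: (boolP (x \in cube (- M) M)) => /=.
    by rewrite inE => /wA; rewrite ler_norml mulr1 ge_max A0 andbT => /andP[].
  by rewrite notin_setE => /w0 ->; rewrite maxxx mulr0.
have [d d0 H] := compact_support_uc cw w0 e0; exists d => // x y /H.
rewrite ltr_norml => /andP[h1 h2].
rewrite ge_max; apply/andP; split.
  have : w y <= Num.max (w y) 0 by rewrite le_max lexx.
  by move: h2 => /=; lra.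
by rewrite addr_ge0 ?(ltW e0)// le_max lexx orbT.
Qed.

Lemma pos_sub_neg (z : R) : z = Num.max z 0 - Num.max (- z) 0.
Proof.
case: (leP 0 z) => z0; first by rewrite max_r ?subr0// oppr_le0.
by rewrite max_l ?opprK ?add0r// oppr_ge0 ltW.
Qed.

(** * Integration by parts through small translations *)

(** Shifts of length at most [1] are absorbed by enlarging the cube by [1]; hence the recurring
    [M + 1]. *)
Lemma cube_shiftN n (M s : R) (i : 'I_n) (x : 'rV[R]_n) : `|s| <= 1 ->
  cube (- M) M (s *: ebasis R i + x) -> cube (- (M + 1)) (M + 1) x.
Proof.
move=> s1 /cube_normP H; apply/cube_normP => j; have := H j; rewrite !mxE eqxx/= => hj.
rewrite -[x 0 j](addKr (s * (j == i)%:R)) addrC.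
apply: le_trans (ler_normD _ _) _; rewrite lerD// normrN normrM.
by apply: le_trans s1; rewrite ler_piMr//; case: (_ == _); rewrite ?normr1 ?normr0.
Qed.

(** By the mean value theorem the increment is [s] times the partial derivative at an intermediate
    point, which uniform continuity compares with its value at [x]. Off the enlarged cube every term
    vanishes. *)
Lemma increment_le n (M e : R) (w : 'rV[R]_n -> R) (i : 'I_n) : 0 < e ->
  continuous w -> (forall x, derivable w x (ebasis R i)) -> continuous (partial i w) ->
  vanishes_off_cube M w ->
  vanishes_off_cube M (partial i w) ->
  exists2 s : R, 0 < s <= 1 & forall x,
    w (s *: ebasis R i + x) <= w x + s * partial i w x
      + s * e * \1_(cube (- (M + 1)) (M + 1)) x.
Proof.
move=> e0 cw dw ch w0 h0.
have [d d0 Hd] := compact_support_uc ch h0 e0.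
(* The bound [d / 2] puts [s] strictly below the modulus [d], and the bound [1] keeps the shifted
   support in the enlarged cube. *)
have [s0 s1 sd] : [/\ 0 < Num.min (d / 2) 1, Num.min (d / 2) 1 <= 1 & Num.min (d / 2) 1 < d].
  rewrite lt_min ge_min gt_min lexx orbT divr_gt0//=; split=> //; apply/orP; left.
  by lra.
exists (Num.min (d / 2) 1); first by rewrite s0.
move: (Num.min _ _) s0 s1 sd => s s0 s1 sd x.
have [xM|xM] := pselect (cube (- (M + 1)) (M + 1) x); last first.
  rewrite indicE memNset// mulr0 addr0.
  have xM' : ~ cube (- M) M x.
    move=> H; apply: xM; move: H; rewrite -{1}[x]add0r -(scale0r (ebasis R i)).
    by apply: cube_shiftN; rewrite normr0.
  rewrite (w0 _ xM') (h0 _ xM') mulr0 addr0 w0// => H.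
  by apply: xM; apply: cube_shiftN H; rewrite gtr0_norm.
rewrite indicE mem_set// mulr1.
have dF (t : R) : is_derive t 1 (fun s : R => w (s *: ebasis R i + x))
    (partial i w (t *: ebasis R i + x)).
  by apply/is_derive_line; apply: DeriveDef; [exact: dw|].
have [t] := MVT s0 (fun t _ => dF t)
  (derivable_within_continuous (fun t _ => @ex_derive _ _ _ _ _ _ _ (dF t))).
rewrite in_itv/= scale0r add0r subr0 => /andP[t0 ts] E.
suff : partial i w (t *: ebasis R i + x) <= partial i w x + e.
  by move=> h; have := ler_wpM2l (ltW s0) h; move: E; lra.
have : `|partial i w (t *: ebasis R i + x) - partial i w x| < e.
  apply: Hd => j; rewrite !mxE eqxx/= addrK normrM gtr0_norm//.
  apply: le_lt_trans (lt_trans ts sd); rewrite ler_piMr ?(ltW t0)//.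
  by case: (_ == _); rewrite ?normr1 ?normr0.
by rewrite ltr_norml => /andP[]; lra.
Qed.

(* Integrating increment_le cancels w against its translate, which has the same
   iterated integral; this gives integration by parts without Fubini's theorem. *)
Lemma iint_partial_neg_le n (M : R) (w : 'rV[R]_n -> R) (i : 'I_n) : 0 <= M ->
  continuous w -> (forall x, derivable w x (ebasis R i)) -> continuous (partial i w) ->
  vanishes_off_cube M w ->
  vanishes_off_cube M (partial i w) ->
  (iint (fun x => (Num.max (- partial i w x) 0)%:E) <=
   iint (fun x => (Num.max (partial i w x) 0)%:E))%E.
Proof.
move=> M0 cw dw ch w0 h0; have M10 : 0 <= M + 1 by lra.
have M2 : - (M + 1) <= M + 1 by lra.
have sub (f : 'rV[R]_n -> R) : vanishes_off_cube M f -> vanishes_off_cube (M + 1) f.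
  move=> f0 x xM; apply: f0 => /cube_normP H; apply: xM; apply/cube_normP => j.
  by apply: le_trans (H j) _; lra.
have subN (f : 'rV[R]_n -> R) : vanishes_off_cube (M + 1) f ->
    vanishes_off_cube (M + 1) (fun x => - f x).
  by move=> f0 x /f0 ->; rewrite oppr0.
have cN (f : 'rV[R]_n -> R) : continuous f -> continuous (fun x => - f x).
  by move=> cf x; apply: continuousN; exact: cf.
pose I f := iint (fun x : 'rV[R]_n => (Num.max (f x) 0)%:E).
have mz (z : R) : 0 <= Num.max z 0 by rewrite le_max lexx orbT.
have max0 (f : 'rV[R]_n -> R) x : 0 <= Num.max (f x) 0 by rewrite le_max lexx orbT.
have uc (f : 'rV[R]_n -> R) : continuous f -> vanishes_off_cube (M + 1) f ->
    bounded_uc (M + 1) (fun x => Num.max (f x) 0) by exact: bounded_uc_pos.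
have it (f : 'rV[R]_n -> R) : continuous f -> vanishes_off_cube (M + 1) f ->
    iterable (fun x => Num.max (f x) 0).
  by move=> cf f0; apply: bounded_uc_iterable M10 (uc _ cf f0).
have fin (f : 'rV[R]_n -> R) : continuous f -> vanishes_off_cube (M + 1) f ->
    I f = (fine (I f))%:E.
  by move=> cf f0; rewrite fineK//; apply: bounded_uc_fin M10 (uc _ cf f0).
have w1 := sub _ w0; have h1 := sub _ h0.
pose V := (M + 1 - - (M + 1)) ^+ n.
have V0 : 0 <= V by rewrite exprn_ge0// subr_ge0.
(* An error of [e] times the volume [V] of the enlarged cube is allowed; taking [e / (V + 1)] makes
   it arbitrarily small. *)
suff H (e : R) : 0 < e -> fine (I (fun x => - partial i w x)) <= fine (I (partial i w)) + e * V.
  rewrite -/(I (fun x => - partial i w x)) -/(I (partial i w)).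
  rewrite (fin _ (cN _ ch) (subN _ h1)) (fin _ ch h1) lee_fin.
  apply/ler_addgt0Pr => e e0; have e'0 : 0 < e / (V + 1) by rewrite divr_gt0// ltr_wpDl.
  apply: le_trans (H _ e'0) _; rewrite lerD2l mulrAC ler_pdivrMr ?ltr_wpDl//.
  by rewrite ler_pM2l// lerDl.
move=> e0; have [s /andP[s0 s1] Hs] := increment_le e0 cw dw ch w0 h0.
pose ws x := w (s *: ebasis R i + x).
have cws : continuous ws.
  move=> x; apply: (@continuous_comp _ _ _ (fun x => s *: ebasis R i + x) w); last exact: cw.
  apply: (@continuousD _ _ _ (fun=> s *: ebasis R i) (fun x => x)).
    exact: cst_continuous.
  exact: (@cvg_id _ (nbhs x)).
have ws1 : vanishes_off_cube (M + 1) ws.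
  by move=> x xM; apply: w0 => H; apply: xM; apply: cube_shiftN H; rewrite gtr0_norm.
have P : I ws = I w by exact: (iint_shift s i M10 (uc _ cw w1)).
have N : I (fun x => - ws x) = I (fun x => - w x).
  exact: (iint_shift s i M10 (uc _ (cN _ cw) (subN _ w1))).
(* [increment_le] is rearranged so that only positive parts occur on either side, since [iintD]
   concerns nonnegative functions. *)
have L : (iint (fun x => (Num.max (ws x) 0 + Num.max (- w x) 0
                      + s * Num.max (- partial i w x) 0)%:E)
  <= iint (fun x => (Num.max (w x) 0 + Num.max (- ws x) 0 + s * Num.max (partial i w x) 0
                      + s * e * \1_(cube (- (M + 1)) (M + 1)) x)%:E))%E.
  apply: le_iint => x; rewrite lee_fin.
    by rewrite addr_ge0 ?addr_ge0 ?mulr_ge0 ?mz ?(ltW s0).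
  have := Hs x; rewrite -/(ws x) {1}[ws x]pos_sub_neg {1}[w x]pos_sub_neg.
  rewrite {1}[partial i w x]pos_sub_neg.
  by rewrite mulrBr; lra.
have s00 := ltW s0; have se0 : 0 <= s * e by rewrite mulr_ge0// ltW.
have cNw := cN _ cw; have cNws := cN _ cws; have cNh := cN _ ch.
have w1N := subN _ w1; have ws1N := subN _ ws1; have h1N := subN _ h1.
have ia (a b : 'rV[R]_n -> R) : continuous a -> continuous b ->
   vanishes_off_cube (M + 1) a -> vanishes_off_cube (M + 1) b ->
   iterable (fun x : 'rV[R]_n => Num.max (a x) 0 + Num.max (b x) 0).
  by move=> *; apply: iterableD => //; exact: it.
have is_ (a : 'rV[R]_n -> R) : continuous a -> vanishes_off_cube (M + 1) a ->
   iterable (fun x : 'rV[R]_n => s * Num.max (a x) 0).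
  by move=> *; apply: iterableZl => //; exact: it.
have e3 (a b c : 'rV[R]_n -> R) : continuous a -> continuous b -> continuous c ->
   vanishes_off_cube (M + 1) a -> vanishes_off_cube (M + 1) b ->
   vanishes_off_cube (M + 1) c ->
   iint (fun x => (Num.max (a x) 0 + Num.max (b x) 0 + s * Num.max (c x) 0)%:E) =
   (fine (I a) + fine (I b) + s * fine (I c))%:E.
  move=> ca cb cc a0 b0 c0; rewrite iintD;
    [|exact: ia|exact: is_|by move=> x; rewrite addr_ge0 ?mz|by move=> x; rewrite mulr_ge0 ?mz].
  rewrite iintD; [|exact: it|exact: it|by move=> x; rewrite mz|by move=> x; rewrite mz].
  rewrite iintZl; [|exact: it|exact: s00|by move=> x; rewrite mz].
  by rewrite -/(I a) -/(I b) -/(I c) (fin a)// (fin b)// (fin c)// -EFinM -!EFinD.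
have it1 : iterable (fun x => Num.max (w x) 0 + Num.max (- ws x) 0 + s * Num.max (partial i w x) 0).
  apply: iterableD => [||x|x]; [exact: ia|exact: is_| |].
  - by rewrite addr_ge0 ?mz.
  - by rewrite mulr_ge0 ?mz.
have it2 := @iterable_cube R n _ _ _ se0 M2.
move: L; rewrite (iintD it1 it2) => [|x|x]; last 2 first.
- by rewrite addr_ge0 ?addr_ge0 ?mulr_ge0 ?mz.
- by rewrite mulr_ge0 ?indicE ?ler0n.
(* By [P] and [N] the parts of [ws] integrate to those of [w] and cancel; the common factor [s] is
   then divided out. *)
rewrite !e3// iint_cube// -/V -EFinD lee_fin P N => L.
by rewrite -(ler_pM2l s0) mulrDr mulrA; lra.
Qed.

(** The inequality just proved, applied to [w] and to [- w], gives both directions. The partial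
    derivative of a compactly supported function thus has integral zero. *)
Lemma iint_partial_pos_neg n (M : R) (w : 'rV[R]_n -> R) (i : 'I_n) : 0 <= M ->
  continuous w -> (forall x, derivable w x (ebasis R i)) -> continuous (partial i w) ->
  vanishes_off_cube M w ->
  vanishes_off_cube M (partial i w) ->
  iint (fun x => (Num.max (partial i w x) 0)%:E) =
  iint (fun x => (Num.max (- partial i w x) 0)%:E).
Proof.
move=> M0 cw dw ch w0 h0; apply/eqP; rewrite eq_le; apply/andP; split; last first.
  exact: iint_partial_neg_le w0 h0.
have pN x : partial i (fun x => - w x) x = - partial i w x by exact: deriveN.
have pNE : partial i (fun x => - w x) = fun x => - partial i w x by exact/funext.
have := @iint_partial_neg_le n M (fun x => - w x) i M0.
have NN : (fun x => (Num.max (- - partial i w x) 0)%:E) = fun x => (Num.max (partial i w x) 0)%:E.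
  by apply/funext => x; rewrite opprK.
rewrite pNE NN; apply.
- by move=> x; apply: continuousN; exact: cw.
- by move=> x; exact: derivableN.
- by move=> x; apply: continuousN; exact: ch.
- by move=> x /w0 ->; rewrite oppr0.
- by move=> x /h0 ->; rewrite oppr0.
Qed.

Lemma partial_notin_supp n (i : 'I_n) (psi : 'rV[R]_n -> R) x :
  ~ supp psi x -> partial i psi x = 0.
Proof.
move=> xs; rewrite /partial (_ : 'D_(ebasis R i) psi x = 'D_(ebasis R i) (cst 0) x).
  exact: derive_cst.
apply: near_eq_derive.
have : nbhs x (~` supp psi).
  by apply: open_nbhs_nbhs; split => //; exact/closed_openC/closed_closure.
apply: filterS => y ys; apply/eqP/negP => /negP H; apply: ys; exact: subset_closure.
Qed.

(** By the product rule the integrand is the partial derivative of [u * psi], a compactly supported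
    function to which [iint_partial_pos_neg] applies. *)
Lemma weak_partial_C1 n (G : set 'rV[R]_n) (u : 'rV[R]_n -> R) (i : 'I_n) :
  continuous u -> (forall x, derivable u x (ebasis R i)) -> continuous (partial i u) ->
  weak_partial G u i (partial i u).
Proof.
move=> cu du cpu psi [spsi [cpsi psiG]] h.
have [cp dp] : continuous psi /\ forall x, derivable psi x (ebasis R i).
  by have [cp dp] := spsi [::]; split; [exact: cp|exact: dp].
have cpp : continuous (partial i psi) by have [] := spsi [:: i].
have psi0 x : ~ supp psi x -> psi x = 0.
  by move=> xs; apply/eqP/negP => /negP H; apply: xs; exact: subset_closure.
(* The indicator of [G] disappears: it is [1] on the support of [psi], and off that support [psi]
   and its partial derivative are both [0]. *)
have hE : h = partial i (fun x => u x * psi x).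
  apply/funext => x; rewrite /h /partial deriveM// -/(partial i psi x) -/(partial i u x).
  rewrite /GRing.scale/= [psi x * _]mulrC.
  have [xs|xs] := pselect (supp psi x).
    by rewrite indicE mem_set ?mul1r//; exact: psiG.
  by rewrite psi0// partial_notin_supp// !mulr0 addr0 mulr0.
have [M M0 sM] := compact_sub_cube cpsi.
have h0 x : ~ cube (- M) M x -> h x = 0.
  move=> xM; have xs : ~ supp psi x by move=> /sM.
  by rewrite /h psi0// partial_notin_supp// !mulr0 addr0 mulr0.
have ch : continuous h.
  rewrite (_ : h = fun x => u x * partial i psi x + partial i u x * psi x); last first.
    rewrite hE; apply/funext => x; rewrite /partial deriveM// -/(partial i psi x) -/(partial i u x).
    by rewrite /GRing.scale/= [psi x * _]mulrC.
  move=> x; apply: (@continuousD _ _ _ (fun x => u x * partial i psi x)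
    (fun x => partial i u x * psi x)); apply: continuousM.
  - exact: cu.
  - exact: cpp.
  - exact: cpu.
  - exact: cp.
split.
  have [A A0 hA] := continuous_bounded_on_compact ch (@compact_cube n (- M) M).
  apply: (@le_lt_trans _ _ (iint (fun x : 'rV[R]_n => (A * \1_(cube (- M) M) x)%:E))).
    apply: le_iint => x; rewrite lee_fin// indicE.
    have [xM|xM] := pselect (cube (- M) M x); first by rewrite mem_set// mulr1 hA.
    by rewrite h0// normr0 mulr_ge0.
  by rewrite iint_cube ?ltry//; lra.
rewrite hE; apply: (@iint_partial_pos_neg _ M); first exact: M0.
- by move=> x; apply: continuousM; [exact: cu|exact: cp].
- by move=> x; apply: derivableM; [exact: du|exact: dp].
- by rewrite -hE; exact: ch.
- by move=> x xM; rewrite psi0 ?mulr0// => /sM.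
- by rewrite -hE; exact: h0.
Qed.

Lemma loc_int_continuous n (G : set 'rV[R]_n) (f : 'rV[R]_n -> R) :
  continuous f -> loc_int G f.
Proof.
move=> cf; split=> [B oB|K cK _].
  by apply: sub_sigma_algebra; move/continuousP: cf; exact.
have [A A0 fA] := continuous_bounded_on_compact cf cK.
have [M M0 KM] := compact_sub_cube cK.
apply: (@le_lt_trans _ _ (iint (fun x : 'rV[R]_n => (A * \1_(cube (- M) M) x)%:E))).
  apply: le_iint => x; rewrite lee_fin; first by rewrite mulr_ge0.
  have [xK|xK] := pselect (K x).
    by rewrite !indicE !mem_set//; [rewrite mul1r mulr1 fA|exact: KM].
  by rewrite indicE memNset// mul0r mulr_ge0.
by rewrite iint_cube ?ltry//; lra.
Qed.

End WeakDerivative.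

(** * The scaling argument *)

Section Bump.
Set Implicit Arguments. Unset Strict Implicit.
Context {R : realType}.
Implicit Types (n : nat).

(** * The bump function and its gradient *)

(** This is why the bump squares the positive part: the square has a continuous derivative across
    [0]. *)
Lemma is_derive_pos_sqr (y : R) :
  is_derive y 1 (fun z : R => Num.max z 0 ^+ 2) (2 * Num.max y 0).
Proof.
case: (ltgtP y 0) => [y0|y0|->].
- rewrite mulr0.
  apply: (@near_eq_is_derive _ _ _ (cst (0 : R))).
  near=> z; rewrite /cst max_r ?expr0n//; apply: ltW; near: z.
  exact: lt_nbhsl.
- have d2 : is_derive y 1 (fun z : R => z ^+ 2) (2 * y).
    by apply: is_derive_eq; rewrite /GRing.scale/= mulr1 mulr_natl mulr2n.
  apply: (near_eq_is_derive _ d2).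
  near=> z; rewrite max_l//; apply: ltW; near: z; exact: lt_nbhsr.
(* At [0] the slope function in Carathéodory's criterion is the positive part itself, which is
   continuous and vanishes there. *)
- apply/is_derive1_caratheodory; exists (fun z => Num.max z 0); split.
  + move=> z; rewrite maxxx expr0n/= !subr0 expr2.
    by case: (leP 0 z) => z0; rewrite ?mul0r.
  + apply: (@continuous_max _ _ (fun z : R => z) (fun=> 0)); [exact: cvg_id|exact: cvg_cst].
  + by rewrite maxxx ?mulr0.
Unshelve. all: by end_near. Qed.

Definition scaled_coord n (L : R) (x : 'rV[R]_n) (j : 'I_n) : R := (x 0 j - 2 * L) / L.
Definition gap n (L : R) (x : 'rV[R]_n) : R := 1 - \sum_j scaled_coord L x j ^+ 2.
Definition bump n (L : R) (x : 'rV[R]_n) : R := Num.max (gap L x) 0 ^+ 2.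

Lemma scaled_coord_continuous n (L : R) (j : 'I_n) :
  continuous (fun x : 'rV[R]_n => scaled_coord L x j).
Proof.
move=> x; apply: (@continuousM _ _ (fun x : 'rV[R]_n => x 0 j - 2 * L) (fun=> L^-1)).
  apply: (@continuousB _ _ _ (fun x : 'rV[R]_n => x 0 j) (fun=> 2 * L)).
    exact: coord_continuous.
  exact: cst_continuous.
exact: cst_continuous.
Qed.

Lemma pos_gap_continuous n (L : R) : continuous (fun x : 'rV[R]_n => Num.max (gap L x) 0).
Proof.
move=> x; apply: (@continuous_max _ _ (@gap n L) (fun=> 0)); last exact: cst_continuous.
rewrite /gap; apply: (@continuousB _ R^o _ (fun=> 1)
  (fun x : 'rV[R]_n => \sum_j scaled_coord L x j ^+ 2)); first exact: cst_continuous.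
apply: (@continuous_big _ _ _ _ _ _ _ _ (fun j (x : 'rV[R]_n) => scaled_coord L x j ^+ 2)) => [|j _].
  exact: add_continuous.
move=> y; apply: (@continuous_comp _ _ _ (fun x : 'rV[R]_n => scaled_coord L x j) (fun z => z ^+ 2)).
  exact: scaled_coord_continuous.
exact: exprn_continuous.
Qed.

Lemma bump_continuous n (L : R) : continuous (@bump n L).
Proof.
move=> x; apply: (@continuous_comp _ _ _ (fun x : 'rV[R]_n => Num.max (gap L x) 0) (fun z => z ^+ 2)).
  exact: pos_gap_continuous.
exact: exprn_continuous.
Qed.

(** Along a coordinate line [gap] is a quadratic polynomial in [s], whose linear coefficient gives
    its partial derivative. *)
Lemma gap_line n (L s : R) (x : 'rV[R]_n) (i : 'I_n) :
  gap L (s *: ebasis R i + x) = gap L x - (s * 2 * (scaled_coord L x i / L) + (s / L) ^+ 2).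
Proof.
rewrite /gap (bigD1 i)//= [in RHS](bigD1 i)//=.
have -> : \sum_(j < n | j != i) scaled_coord L (s *: ebasis R i + x) j ^+ 2 =
    \sum_(j < n | j != i) scaled_coord L x j ^+ 2.
  by apply: eq_bigr => j ji; rewrite /scaled_coord !mxE (negbTE ji) andbF mulr0 add0r.
rewrite /scaled_coord !mxE !eqxx/= mulr1; ring.
Qed.

Lemma is_derive_bump n (L : R) (x : 'rV[R]_n) (i : 'I_n) :
  is_derive x (ebasis R i) (bump L) (- (4 / L) * (Num.max (gap L x) 0 * scaled_coord L x i)).
Proof.
rewrite -[x in is_derive x]add0r -(scale0r (ebasis R i)); apply/is_derive_line.
have dg : is_derive (0 : R) 1 (fun s : R => gap L (s *: ebasis R i + x)) (- (2 * (scaled_coord L x i / L))).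
  under eq_fun do rewrite gap_line.
  apply: is_derive_eq.
  rewrite /GRing.scale/=; ring.
have E0 : gap L x = gap L (0 *: ebasis R i + x) by rewrite scale0r add0r.
have H : is_derive (0 : R) 1 (fun s : R => bump L (s *: ebasis R i + x))
    (2 * Num.max (gap L (0 *: ebasis R i + x)) 0 * - (2 * (scaled_coord L x i / L))).
  exact: (@is_derive1_comp R (fun z => Num.max z 0 ^+ 2) _ _ _ _ (is_derive_pos_sqr _) dg).
by apply: (@is_derive_eq _ _ _ _ _ _ _ _ H); rewrite -E0; ring.
Qed.

Lemma partial_bump n (L : R) (i : 'I_n) :
  partial i (bump L) = fun x : 'rV[R]_n => - (4 / L) * (Num.max (gap L x) 0 * scaled_coord L x i).
Proof. by apply/funext => x; have [_] := is_derive_bump L x i. Qed.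

Lemma partial_bump_continuous n (L : R) (i : 'I_n) : continuous (partial i (@bump n L)).
Proof.
rewrite partial_bump => x.
apply: (@continuousM _ _ (fun=> - (4 / L)) (fun x : 'rV[R]_n => Num.max (gap L x) 0 * scaled_coord L x i)).
  exact: cst_continuous.
apply: (@continuousM _ _ (fun x : 'rV[R]_n => Num.max (gap L x) 0) (fun x => scaled_coord L x i)).
  exact: pos_gap_continuous.
exact: scaled_coord_continuous.
Qed.

(** A single coordinate outside [[L, 3L]] already contributes at least [1] to the sum of squares. *)
Lemma gap_le0 n (L : R) (x : 'rV[R]_n) : 0 < L ->
  ~ cube L (3 * L) x -> Num.max (gap L x) 0 = 0.
Proof.
move=> L0 /existsNP[i xi]; apply: max_r; rewrite subr_le0 (bigD1 i)//=.
apply: ler_wpDr; first by apply: sumr_ge0 => j _; exact: sqr_ge0.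
rewrite -[leLHS](expr1n _ 2) -[leRHS]real_normK ?num_real// lerXn2r ?nnegrE// leNgt.
apply/negP => h; apply: xi; move: h.
rewrite /scaled_coord normrM normfV (gtr0_norm L0) ltr_pdivrMr// mul1r ltr_norml => /andP[h1 h2].
by apply/andP; split; lra.
Qed.

Lemma gap_le1 n (L : R) (x : 'rV[R]_n) : gap L x <= 1.
Proof. by rewrite gerBl sumr_ge0// => i _; exact: sqr_ge0. Qed.

(** On the cube the positive part of [gap] and the scaled coordinates are at most [1] in absolute
    value, so each partial derivative is at most [4 / L]. The factor [n] is a crude bound for the
    square root of [n]. *)
Lemma grad_bump_le n (L : R) (x : 'rV[R]_n) : 0 < L -> (0 < n)%N ->
  `|grad_norm (fun i => partial i (bump L)) x| <= 4 * n%:R / L * \1_(cube L (3 * L)) x.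
Proof.
move=> L0 n0; rewrite /grad_norm /enorm ger0_norm ?sqrtr_ge0//.
have [xc|xc] := pselect (cube L (3 * L) x); last first.
  rewrite big1 ?sqrtr0; first by rewrite indicE memNset// mulr0.
  by move=> i _; rewrite mxE partial_bump gap_le0// mul0r mulr0 expr0n.
have K0 : 0 <= 4 * n%:R / L by rewrite divr_ge0 ?mulr_ge0// ltW.
rewrite indicE mem_set// mulr1 -(ger0_norm K0) -sqrtr_sqr ler_wsqrtr//.
apply: (@le_trans _ _ (\sum_(i < n) (4 / L) ^+ 2)).
  apply: ler_sum => i _; rewrite mxE partial_bump -[leLHS]real_normK ?num_real//.
  rewrite lerXn2r ?nnegrE ?divr_ge0 ?(ltW L0)//.
  rewrite normrM normrN (@ger0_norm _ (4 / L)) ?divr_ge0 ?(ltW L0)//.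
  rewrite ler_piMr ?divr_ge0 ?(ltW L0)// normrM mulr_ile1//.
    by rewrite ger0_norm ?ge_max ?gap_le1 ?ler01// le_max lexx orbT.
  rewrite /scaled_coord normrM normfV (gtr0_norm L0) ler_pdivrMr// mul1r ler_norml.
  by have /andP[h1 h2] := xc i; apply/andP; split; lra.
rewrite sumr_const card_ord -[X in X <= _]mulr_natl.
rewrite (_ : 4 * n%:R / L = n%:R * (4 / L)); last by ring.
rewrite [leRHS]exprMn ler_wpM2r ?sqr_ge0// expr2 ler_peMl// ler1n//.
Qed.

(** The side [L / n] puts the scaled coordinates in [[0, 1/n]]; their squares sum to at most [1/n],
    hence to at most [1/2]. *)
Lemma bump_ge n (L : R) (x : 'rV[R]_n) : 0 < L -> (2 <= n)%N ->
  cube (2 * L) (2 * L + L / n%:R) x -> 4^-1 <= bump L x.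
Proof.
move=> L0 n2 xc; have n0 : 0 < n%:R :> R by rewrite ltr0n (leq_trans _ n2).
suff h : 2^-1 <= gap L x.
  rewrite /bump (_ : 4^-1 = 2^-1 ^+ 2); last by field.
  by rewrite lerXn2r ?nnegrE ?le_max ?h// ?lexx ?orbT// invr_ge0.
have : \sum_j scaled_coord L x j ^+ 2 <= \sum_(j < n) (n%:R^-1) ^+ 2.
  apply: ler_sum => j _; have /andP[h1 h2] := xc j.
  have h0 : 0 <= scaled_coord L x j by rewrite divr_ge0 ?(ltW L0)//; lra.
  rewrite lerXn2r ?nnegrE ?invr_ge0 ?(ltW n0)// /scaled_coord ler_pdivrMr// mulrC; lra.
rewrite sumr_const card_ord -[X in _ <= X -> _]mulr_natl expr2 mulrA divff ?gt_eqF// mul1r => h.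
have : n%:R^-1 <= 2^-1 :> R by rewrite lef_pV2 ?posrE// (ler_nat R 2).
by rewrite /gap; lra.
Qed.

Lemma bump_eq0 n (L : R) (x : 'rV[R]_n) : 0 < L -> (0 < n)%N ->
  cube (4 * L) (4 * L + L / n%:R) x -> bump L x = 0.
Proof.
move=> L0 n0 xc; rewrite /bump gap_le0 ?expr0n// => /(_ (Ordinal n0)).
by have := xc (Ordinal n0) => /andP[h1 h2] /andP[h3 h4]; lra.
Qed.

(** * Norm estimates on cubes and comparison of powers *)

Lemma ler_Lnorm_cube n (G : set 'rV[R]_n) (s A lo hi : R) (f : 'rV[R]_n -> R) :
  0 < s -> 0 <= A -> lo <= hi -> (forall x, `|f x| <= A * \1_(cube lo hi) x) ->
  (Lnorm_on G s f <= ((A `^ s * (hi - lo) ^+ n) `^ s^-1)%:E)%E.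
Proof.
move=> s0 A0 lh fA; rewrite -poweR_EFin -iint_cube ?powR_ge0//.
have h0 x : 0 <= \1_G x * `|f x| `^ s by rewrite mulr_ge0 ?powR_ge0.
apply: gt0_ler_poweR; rewrite ?invr_ge0 ?(ltW s0)// ?in_itv/= ?leey ?andbT.
- exact: iint_EFin_ge0.
- by apply: iint_EFin_ge0 => x; rewrite mulr_ge0 ?powR_ge0.
apply: le_iint => x; rewrite lee_fin//.
apply: (@le_trans _ _ (`|f x| `^ s)).
  by rewrite ler_piMl ?powR_ge0// indicE; case: (_ \in _).
have := fA x; rewrite indicE; case: (_ \in _) => /=; rewrite ?mulr1 ?mulr0 => h.
  by rewrite ge0_ler_powR ?nnegrE ?(ltW s0).
(* Off the cube [f] vanishes, and [0] to the power [s] is [0] because [s] is nonzero. *)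
have -> : `|f x| = 0 by apply/eqP; rewrite eq_le h normr_ge0.
by rewrite powR0// gt_eqF.
Qed.

Lemma ger_Lnorm_cube n (G : set 'rV[R]_n) (s A lo hi : R) (f : 'rV[R]_n -> R) :
  0 < s -> 0 <= A -> lo <= hi -> cube lo hi `<=` G ->
  (forall x, cube lo hi x -> A <= `|f x|) ->
  (((A `^ s * (hi - lo) ^+ n) `^ s^-1)%:E <= Lnorm_on G s f)%E.
Proof.
move=> s0 A0 lh cG fA; rewrite -poweR_EFin -iint_cube ?powR_ge0//.
have h0 x : 0 <= \1_G x * `|f x| `^ s by rewrite mulr_ge0 ?powR_ge0.
apply: gt0_ler_poweR; rewrite ?invr_ge0 ?(ltW s0)// ?in_itv/= ?leey ?andbT.
- by apply: iint_EFin_ge0 => x; rewrite mulr_ge0 ?powR_ge0.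
- exact: iint_EFin_ge0.
apply: le_iint => x; rewrite lee_fin; first by rewrite mulr_ge0 ?powR_ge0.
have [xc|xc] := pselect (cube lo hi x).
  rewrite !indicE !mem_set ?mulr1 ?mul1r//; last exact: cG.
  by rewrite ge0_ler_powR ?nnegrE ?(ltW s0)// fA.
by rewrite [X in _ * X <= _]indicE memNset// mulr0.
Qed.

Lemma powR_cube_norm n (s A B : R) : 0 < s -> 0 <= A -> 0 <= B ->
  (A `^ s * B ^+ n) `^ s^-1 = A * B `^ (n%:R / s).
Proof.
move=> s0 A0 B0; rewrite powRM ?powR_ge0 ?exprn_ge0// -powRrM divff ?gt_eqF//.
by rewrite powRr1// -powR_mulrn// -powRrM.
Qed.

(** If [a] and [b] differ, some [L] satisfies [L ^ (a - b) = |K| / k + 1], whatever the sign of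
    [a - b]. For it the left side is [(|K| + k) * L ^ b], which exceeds the right side. *)
Lemma homogeneity_exponent (a b k K : R) : 0 < k ->
  (forall L, 0 < L -> k * L `^ a <= K * L `^ b) -> a = b.
Proof.
move=> k0 H; apply/eqP/negP => /negP ab.
have d0 : a - b != 0 by rewrite subr_eq0.
pose M := `|K| / k + 1.
have M0 : 0 < M by rewrite ltr_wpDl// divr_ge0// ltW.
have [L L0 LM] : exists2 L : R, 0 < L & L `^ (a - b) = M.
  by exists (M `^ (a - b)^-1); rewrite ?powR_gt0// -powRrM mulVf// powRr1// ltW.
have := H _ L0.
have -> : L `^ a = M * L `^ b.
  by rewrite -LM -powRD ?subrK// (gt_eqF L0) implybT.
rewrite mulrA ler_pM2r ?powR_gt0// /M mulrDr mulrCA divff ?gt_eqF// !mulr1.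
by have := ler_norm K; lra.
Qed.

(** Neighbourhoods are balls of the maximum norm, so moving by less than [lo] keeps every coordinate
    positive. *)
Lemma cube_sub_interior n (lo hi : R) (A : set 'rV[R]_n) : 0 < lo ->
  @orthant R n `<=` A -> cube lo hi `<=` interior A.
Proof.
move=> lo0 oA x xc; apply/nbhs_ballP; exists lo => //= y [_ xy]; apply: oA => i.
have /andP[h _] := xc i; have := xy 0 i; rewrite /ball/= ltr_norml => /andP[_]; lra.
Qed.

End Bump.

(** * The exponent and the linear behaviour of [phi] *)

Section MushroomSobolev.
Context {R : realType}.

Lemma sobolev_exponent (n : nat) (G : set 'rV[R]_n) (p q C : R) :
  (2 <= n)%N -> 1 <= p -> p < n%:R -> 1 <= q ->
  (forall lo hi : R, 0 < lo -> cube lo hi `<=` G) ->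
  (forall (u : 'rV[R]_n -> R) (g : 'I_n -> 'rV[R]_n -> R), L1p_with G p u g ->
     (ereal_inf [set Lnorm_on G q (fun x => (u x - b)%R) | b in [set: R]]
       <= C%:E * Lnorm_on G p (grad_norm g))%E) ->
  q = n%:R * p / (n%:R - p).
Proof.
move=> n2 p1 pn q1 GC H.
have n0N : (0 < n)%N by exact: leq_trans n2.
have n0 : 0 < n%:R :> R by rewrite ltr0n.
have p0 : 0 < p by lra.
have q0 : 0 < q by lra.
suff E : n%:R / q = n%:R / p - 1.
  have d0 : n%:R - p != 0 by rewrite gt_eqF// subr_gt0.
  have -> : q = n%:R / (n%:R / q) by field; rewrite !gt_eqF.
  by rewrite E; field; rewrite d0 gt_eqF.
(* The left constant comes from the value [1/8] on a cube of side [L / n], the right one from the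
   gradient bound [4 n / L] on a cube of side [2 L]. *)
apply: (@homogeneity_exponent R _ _ (8^-1 * n%:R^-1 `^ (n%:R / q)) (`|C| * (4 * n%:R) * 2 `^ (n%:R / p))).
  by rewrite mulr_gt0// powR_gt0// invr_gt0.
move=> L L0.
pose g (i : 'I_n) := partial i (@bump R n L).
have K0 : 0 <= 4 * n%:R / L by rewrite divr_ge0 ?mulr_ge0// ltW.
have Lg : (Lnorm_on G p (grad_norm g) <= ((4 * n%:R / L) * (2 * L) `^ (n%:R / p))%:E)%E.
  apply: (@le_trans _ _ (((4 * n%:R / L) `^ p * (3 * L - L) ^+ n) `^ p^-1)%:E).
    apply: ler_Lnorm_cube => //; first by lra.
    by move=> x; exact: grad_bump_le.
  rewrite powR_cube_norm//; last by lra.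
  by rewrite (_ : 3 * L - L = 2 * L)//; lra.
have bumpL1p : L1p_with G p (bump L) g.
  split; first exact/loc_int_continuous/bump_continuous.
  split=> [i|]; last exact: le_lt_trans Lg (ltry _).
  split; first exact/loc_int_continuous/partial_bump_continuous.
  apply: weak_partial_C1; [exact: bump_continuous| |exact: partial_bump_continuous].
  by move=> x; have [] := is_derive_bump L x i.
have low : ((8^-1 * (L / n%:R) `^ (n%:R / q))%:E <=
    ereal_inf [set Lnorm_on G q (fun x => (bump L x - b)%R) | b in [set: R]])%E.
  have Ln0 : 0 <= L / n%:R by rewrite divr_ge0// ltW.
  apply: le_ereal_inf_tmp => _ [b _ <-].
  rewrite -powR_cube_norm//.
  (* If b <= 1/8, test on a cube where u_L >= 1/4; otherwise on one where u_L = 0. *)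
  case: (leP b (8^-1)) => hb.
    rewrite (_ : L / n%:R = 2 * L + L / n%:R - 2 * L); last by lra.
    apply: ger_Lnorm_cube => //; [lra|apply: GC; lra|].
    move=> x /(bump_ge L0 n2) h; apply: le_trans (ler_norm _); lra.
  rewrite (_ : L / n%:R = 4 * L + L / n%:R - 4 * L); last by lra.
  apply: ger_Lnorm_cube => //; [lra|apply: GC; lra|].
  by move=> x /(bump_eq0 L0 n0N) ->; rewrite sub0r normrN; apply: le_trans (ler_norm _); lra.
have Lg0 : (0 <= Lnorm_on G p (grad_norm g))%E by exact: poweR_ge0.
have := le_trans low (H _ _ bumpL1p).
(* The sign of [C] is unknown; passing to its absolute value allows multiplying the gradient
   estimate by it. *)
have C1 : (C%:E * Lnorm_on G p (grad_norm g) <= `|C|%:E * Lnorm_on G p (grad_norm g))%E.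
  by apply: lee_wpmul2r => //; rewrite lee_fin ler_norm.
have C2 : (`|C|%:E * Lnorm_on G p (grad_norm g) <= `|C|%:E * ((4 * n%:R / L) * (2 * L) `^ (n%:R / p))%:E)%E.
  by apply: lee_wpmul2l => //; rewrite lee_fin.
move=> /le_trans /(_ C1) /le_trans /(_ C2); rewrite -EFinM lee_fin.
rewrite powRM ?(ltW L0) ?invr_ge0 ?(ltW n0)// powRM ?(ltW L0)// => h.
(* The factor [1 / L] of the gradient bound is the [- 1] in the exponent [n / p - 1]. *)
rewrite powRB; last by rewrite (gt_eqF L0) implybT.
rewrite powRr1 ?(ltW L0)//; move: h.
set u := L `^ _; set v := L `^ _; set w := _ `^ _; set z := _ `^ _.
by congr (_ <= _); ring.
Qed.

(** Finiteness of the limit [m] bounds [phi t / t] from below near [0], and positivity of [m] bounds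
    it from above. *)
Lemma phi_linear (phi : R -> R) (m : R) (r : nat -> R) :
  (forall t, 0 < t -> 0 < phi t) ->
  (fun t => t / phi t) x @[x --> 0^'+] --> m ->
  (forall k, 0 < r k) -> r @ \oo --> 0 -> (forall k, phi (r k) <= r k) ->
  exists t0 : R, 0 < t0 /\
    exists c1 c2 : R, 0 < c1 /\ c1 <= c2 /\
      forall t, 0 < t <= t0 -> c1 * t <= phi t <= c2 * t.
Proof.
move=> phi0 cm r0 cr phir.
have near_m e : 0 < e -> exists2 d : R, 0 < d & forall t, 0 < t -> t < d -> `|m - t / phi t| < e.
  move=> e0; move/cvgrPdist_lt : cm => /(_ e e0)[d /= d0 Hd]; exists d => // t t0 td.
  by apply: Hd => //=; rewrite sub0r normrN gtr0_norm.
(* Along the sequence r the quotient t / phi t is at least 1. *)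
have m1 : 1 <= m.
  rewrite leNgt; apply/negP => m1; have e0 : 0 < 1 - m by lra.
  have [d d0 Hd] := near_m _ e0.
  move/cvgrPdist_lt : cr => /(_ d d0)[N _ /(_ N (leqnn N))] /=.
  rewrite sub0r normrN gtr0_norm// => rd.
  have := Hd _ (r0 N) rd; have : 1 <= r N / phi (r N) by rewrite ler_pdivlMr ?mul1r// phi0.
  by move=> h; rewrite ltr_norml => /andP[]; lra.
(* Tolerance [m / 2] confines [t / phi t] to the range from [m / 2] to [2 * m]; inverting these
   bounds gives the two constants. *)
have e0 : 0 < m / 2 by lra.
have [d d0 Hd] := near_m _ e0.
exists (d / 2); split; first by lra.
exists (2 * m)^-1, (2 / m); split; first by rewrite invr_gt0; lra.
split.
  rewrite -subr_ge0 (_ : _ - _ = 3 / 2 / m); last by field; rewrite gt_eqF//; lra.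
  by rewrite divr_ge0//; lra.
move=> t /andP[t0 td].
have td' : t < d by lra.
have := Hd _ t0 td'; have := phi0 _ t0; move: (phi t) => f f0.
rewrite ltr_norml => /andP[h1 h2].
have h3 : m / 2 <= t / f by lra.
have h4 : t / f <= 2 * m by lra.
move: h3 h4; rewrite ler_pdivlMr// ler_pdivrMr// => h3 h4.
rewrite mulrC ler_pdivrMr; last by lra.
rewrite (_ : 2 / m * t = 2 * t / m); last by ring.
rewrite ler_pdivlMr; last by lra.
by apply/andP; split; lra.
Qed.

End MushroomSobolev.

Theorem theorem6p2 (R : realType) (n : nat) (p : R) (phi : R -> R) (m : R)
    (r : nat -> R) (a c aS cS : nat -> 'I_n -> R) (q C : R) :
  (2 <= n)%N -> 1 <= p -> p < n%:R ->
  admissible_phi phi ->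
  (fun t => t / phi t) x @[x --> 0^'+] --> m ->
  mushroom_data phi r a c aS cS ->
  1 <= q ->
  (forall (u : 'rV[R]_n -> R) (g : 'I_n -> 'rV[R]_n -> R),
     L1p_with (mushroom_domain phi r a c aS cS) p u g ->
     (ereal_inf [set Lnorm_on (mushroom_domain phi r a c aS cS) q (fun x => (u x - b)%R)
                 | b in [set: R]]
       <= C%:E * Lnorm_on (mushroom_domain phi r a c aS cS) p (grad_norm g))%E) ->
  q = n%:R * p / (n%:R - p) /\
  exists t0 : R, 0 < t0 /\
    exists c1 c2 : R, 0 < c1 /\ c1 <= c2 /\
      forall t, 0 < t <= t0 -> c1 * t <= phi t <= c2 * t.
Proof.
move=> n2 p1 pn [_ [_ [phi_incr [[phi0 _] _]]]] cm [r0 [_ [cr [phir _]]]] q1 H; split.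
  apply: sobolev_exponent H => // lo hi lo0.
  by apply: cube_sub_interior => //; exact: subsetUl.
apply: phi_linear cm r0 cr phir => t t0.
(* Positivity of [phi] on positive arguments follows from [phi 0 = 0] and strict monotonicity. *)
by rewrite -phi0 phi_incr.
Qed.
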